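(* Let $0<p\leq1$, let $\phi:\mathbb{R}^m\to\mathbb{R}^l$ be a feature map, let $\bm{X}=[\bm{x}_1,\ldots,\bm{x}_n]\in\mathbb{R}^{m\times n}$ be arbitrary, and let $\mathcal{K}(\bm{X})=\phi(\bm{X})^T\phi(\bm{X})$. Let $0\leq w_1\leq w_2\leq\cdots\leq w_n$ be weights and $\bm{W}=\textup{diag}(w_1,\ldots,w_n)$. Then $$\sum_{i=1}^nw_i\sigma_i^p(\phi(\bm{X}))=\min_{\bm{Q}\in\mathbb{R}^{n\times n},\ \bm{Q}^T\bm{Q}=\bm{Q}\bm{Q}^T=\bm{I}_n}\textup{Tr}\Big(\big(\bm{W}^{1/p}\bm{Q}^T\mathcal{K}(\bm{X})\bm{Q}\bm{W}^{1/p}\big)^{p/2}\Big).$$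
   Context: $\phi(\bm{X})=[\phi(\bm{x}_1),\ldots,\phi(\bm{x}_n)]\in\mathbb{R}^{l\times n}$ and $[\mathcal{K}(\bm{X})]_{ij}=\phi(\bm{x}_i)^T\phi(\bm{x}_j)$. $\sigma_1(\bm{Y})\geq\cdots\geq\sigma_n(\bm{Y})\geq0$ denote the singular values of an $l\times n$ matrix $\bm{Y}$ in decreasing order (padded with zeros if $l<n$). For a positive semidefinite matrix $\bm{A}$, $\bm{A}^{p/2}$ is its principal matrix power. $\bm{I}_n$ is the $n\times n$ identity. *)

(* Defs.v *)
From HB Require Import structures.
From mathcomp Require Import all_boot all_order all_algebra.
From mathcomp Require Import boolp classical_sets reals exp.
Set Implicit Arguments. Unset Strict Implicit. Unset Printing Implicit Defensive.
Import Order.TTheory GRing.Theory Num.Theory.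
Local Open Scope ring_scope.

Section Defs.
Variable R : realType.

Definition orthogonal_mx (n : nat) (Q : 'M[R]_n) : Prop :=
  Q^T *m Q = 1%:M /\ Q *m Q^T = 1%:M.

Definition spectral_decomp (n : nat) (A : 'M[R]_n) (Ud : 'M[R]_n * 'rV[R]_n) : Prop :=
  orthogonal_mx Ud.1 /\ A = Ud.1 *m diag_mx Ud.2 *m Ud.1^T /\
  (forall i j : 'I_n, (i <= j)%N -> Ud.2 0 j <= Ud.2 0 i).

(* a chosen spectral decomposition (exists for symmetric A by the spectral theorem) *)
Definition spec (n : nat) (A : 'M[R]_n) : 'M[R]_n * 'rV[R]_n :=
  xget (0, 0) [set Ud | spectral_decomp A Ud].

Definition eigval (n : nat) (A : 'M[R]_n) (i : 'I_n) : R := (spec A).2 0 i.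

Definition psd_pow (n : nat) (A : 'M[R]_n) (q : R) : 'M[R]_n :=
  (spec A).1 *m diag_mx (\row_i powR ((spec A).2 0 i) q) *m (spec A).1^T.

(* singular values of Y (l x n), decreasing, padded with zeros when l < n:
   sigma_i(Y) = sqrt(lambda_i(Y^T Y)) *)
Definition sing_val (l n : nat) (Y : 'M[R]_(l, n)) (i : 'I_n) : R :=
  Num.sqrt (eigval (Y^T *m Y) i).

Definition feat_mx (m l n : nat) (phi : 'cV[R]_m -> 'cV[R]_l) (X : 'M[R]_(m, n))
  : 'M[R]_(l, n) := \matrix_(i < l, j < n) phi (col j X) i 0.

Definition kernel_mx (m l n : nat) (phi : 'cV[R]_m -> 'cV[R]_l) (X : 'M[R]_(m, n))
  : 'M[R]_n := (feat_mx phi X)^T *m feat_mx phi X.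

End Defs.

(* Main.v *)
Require Import Defs.
From HB Require Import structures.
From mathcomp Require Import all_boot all_order all_algebra.
From mathcomp Require Import boolp classical_sets reals exp.
From mathcomp Require Import perm ring lra.
From mathcomp.real_closed Require complex.
Import Order.TTheory GRing.Theory Num.Theory.
Local Open Scope ring_scope.
Set Implicit Arguments.
Unset Strict Implicit.
Unset Printing Implicit Defensive.

(* Let K have eigenvalues lam_i (decreasing), let D = W^(1/p), and let al_i be
   the eigenvalues of A = D Q^T K Q D.  The eigenvector matrix Q of K makes A
   diagonal with entries lam_i d_i^2 and attains the left-hand side.  For the
   lower bound, fix c > 0 and truncate the spectrum of A from below at c,
   giving A' >= A and A' >= c I.  If D is invertible, M = D^-1 A' D^-1
   dominates both Q^T K Q and c D^-2, so by Weyl's monotonicity its eigenvalues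
   mu_i satisfy d_i^2 mu_i >= max(lam_i d_i^2, c), and taking determinants
     prod_i max(lam_i d_i^2, c) <= det A' = prod_i max(al_i, c).
   A singular D is handled by replacing D with D + e and A' with t A', t > 1.
   These inequalities for all c say that the lam_i d_i^2 are weakly
   log-majorized by the al_i, which gives the inequality between the sums of
   (p/2)-th powers. *)

Lemma exists_sorting_perm (R : realDomainType) (n : nat) (v : 'I_n -> R) :
  exists s : 'S_n, forall i j : 'I_n, (i <= j)%N -> v (s j) <= v (s i).
Proof.
case: n v => [|n] v; first by exists 1%g => -[].
pose r := [rel i j : 'I_n.+1 | v j <= v i].
have rtot : total r by move=> i j /=; exact: le_total.
have rtr : transitive r by move=> j i k /= h1 h2; apply: le_trans h2 h1.
have rre : reflexive r by move=> i /=.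
have srt := sort_sorted rtot (ord_tuple n.+1).
have /tuple_permP [s Es] : perm_eq (sort r (ord_tuple n.+1)) (ord_tuple n.+1).
  by rewrite perm_sort.
exists s => i j lij.
have nthE (k : 'I_n.+1) : nth ord0 (sort r (ord_tuple n.+1)) k = s k.
  by rewrite Es -tnth_nth tnth_mktuple tnth_ord_tuple.
have sz : size (sort r (ord_tuple n.+1)) = n.+1 by rewrite size_sort size_tuple.
have := @sorted_leq_nth _ r rtr rre ord0 _ srt i j.
by rewrite !inE sz !ltn_ord !nthE => /(_ isT isT lij).
Qed.

(** * Quadratic forms on row vectors *)

Section QuadraticForm.
Variable R : realType.

Definition qform n (A : 'M[R]_n) (v : 'rV[R]_n) : R := (v *m A *m v^T) 0 0.

Lemma row_mulmx_trE n (u v : 'rV[R]_n) : (u *m v^T) 0 0 = \sum_i u 0 i * v 0 i.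
Proof. by rewrite mxE; apply: eq_bigr => i _; rewrite mxE. Qed.

Lemma qform_diag n (d v : 'rV[R]_n) :
  qform (diag_mx d) v = \sum_i d 0 i * v 0 i ^+ 2.
Proof.
rewrite /qform mul_mx_diag row_mulmx_trE; apply: eq_bigr => i _.
by rewrite mxE; ring.
Qed.

Lemma qform_conj n m (U : 'M[R]_(m, n)) (A : 'M[R]_n) (v : 'rV[R]_m) :
  qform (U *m A *m U^T) v = qform A (v *m U).
Proof. by rewrite /qform trmx_mul !mulmxA. Qed.

Lemma qform1 n (v : 'rV[R]_n) : qform 1%:M v = \sum_i v 0 i ^+ 2.
Proof.
rewrite /qform mulmx1 row_mulmx_trE; apply: eq_bigr => i _; by rewrite expr2.
Qed.

Lemma qform1_ge0 n (v : 'rV[R]_n) : 0 <= qform 1%:M v.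
Proof. by rewrite qform1 sumr_ge0 // => i _; rewrite sqr_ge0. Qed.

Lemma qform1_eq0 n (v : 'rV[R]_n) : (qform 1%:M v == 0) = (v == 0).
Proof.
apply/idP/eqP => [|->]; last by rewrite /qform !mul0mx mxE.
rewrite qform1 psumr_eq0 => [/allP h|i _]; last exact: sqr_ge0.
apply/rowP => i; rewrite mxE.
by have := h i; rewrite mem_index_enum sqrf_eq0 => /(_ isT) /eqP.
Qed.

End QuadraticForm.

(** * The spectral theorem for real symmetric matrices *)

Section RealSpectralTheorem.
Variable R : realType.
Import complex.

(** Algebraic closedness of [R[i]] gives a complex eigenvector [x + iy]; its real or its imaginary
    part, normalized, is the real one. *)
Lemma symmetric_eigenvector n (A : 'M[R]_n.+1) : A^T = A ->
  exists a, exists2 u : 'rV[R]_n.+1, u *m A = a *: u & u *m u^T = 1%:M.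
Proof.
move=> symA.
suff [a [u uA u0]] : exists a, exists2 u : 'rV[R]_n.+1, u *m A = a *: u & u != 0.
  have nu_gt0 : 0 < qform 1%:M u.
    by rewrite lt_neqAle eq_sym qform1_eq0 u0 qform1_ge0.
  exists a, ((Num.sqrt (qform 1%:M u))^-1 *: u).
    by rewrite -scalemxAl uA !scalerA mulrC.
  rewrite linearZ /= -scalemxAl -scalemxAr scalerA.
  have -> : u *m u^T = (qform 1%:M u)%:M.
    by rewrite [LHS]mx11_scalar /qform mulmx1.
  rewrite scale_scalar_mx -invfM -expr2 sqr_sqrtr ?qform1_ge0 //.
  by rewrite mulVf // gt_eqF.
pose AC := map_mx (real_complex R) A.
have [z /eigenvalueP [v vA v0]] : exists z, eigenvalue AC z.
  have /closed_rootP [z] : size (char_poly AC) != 1 by rewrite size_char_poly.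
  by rewrite -eigenvalue_root_char; exists z.
pose x : 'rV[R]_n.+1 := map_mx (@Re R) v.
pose y : 'rV[R]_n.+1 := map_mx (@Im R) v.
have [a [b Ez]] : exists a b, z = (a +i* b)%C by case: (z) => a b; exists a, b.
have ReD : {morph @Re R : s t / s + t} by case=> ? ? [].
have ImD : {morph @Im R : s t / s + t} by case=> ? ? [].
have Re0 : Re (0 : R[i]) = 0 by [].
have Im0 : Im (0 : R[i]) = 0 by [].
have ReM (s : R[i]) t : Re (s * (t%:C)%C) = Re s * t.
  by case: s => p q /=; rewrite mulr0 subr0.
have ImM (s : R[i]) t : Im (s * (t%:C)%C) = Im s * t.
  by case: s => p q /=; rewrite mulr0 add0r.
have xA : x *m A = a *: x - b *: y.
  apply/rowP => k; have /rowP /(_ k) /(congr1 (@Re R)) := vA.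
  rewrite !mxE (big_morph (@Re R) ReD Re0) Ez => E.
  transitivity (\sum_i Re (v 0 i * AC i k)).
    by apply: eq_bigr => j _; rewrite !mxE ReM.
  by rewrite E; case: (v 0 k).
have yA : y *m A = b *: x + a *: y.
  apply/rowP => k; have /rowP /(_ k) /(congr1 (@Im R)) := vA.
  rewrite !mxE (big_morph (@Im R) ImD Im0) Ez => E.
  transitivity (\sum_i Im (v 0 i * AC i k)).
    by apply: eq_bigr => j _; rewrite !mxE ImM.
  by rewrite E; case: (v 0 k) => p q /=; rewrite addrC.
(* Symmetry of A makes the imaginary part b of the eigenvalue vanish. *)
have b0 : b * (qform 1%:M x + qform 1%:M y) = 0.
  have sym_dot (B : 'M[R]_n.+1) : B^T = B -> (x *m B *m y^T) 0 0 = (y *m B *m x^T) 0 0.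
    move=> symB; transitivity ((x *m B *m y^T)^T 0 0); first by rewrite [RHS]mxE.
    by rewrite !trmx_mul trmxK symB mulmxA.
  have := sym_dot _ symA; have := sym_dot _ (trmx1 _ _).
  rewrite xA yA mulmxBl mulmxDl -!scalemxAl /qform !mulmx1.
  set xy := x *m y^T; set yx := y *m x^T; set xx := x *m _; set yy := y *m _.
  rewrite !mxE => -> E.
  by rewrite mulrDr; apply/eqP; rewrite addr_eq0; apply/eqP; move: E; lra.
(* If [x] is nonzero, then [b = 0] and [x] is an eigenvector. If [x] is zero, the term [b *: x]
   drops out of [yA], and [y] is nonzero because [v] is. *)
have [x0|x0] := eqVneq x 0; last first.
  have {}b0 : b = 0.
    apply/eqP; move/eqP: b0; rewrite mulf_eq0 => /orP[//|].
    by rewrite paddr_eq0 ?qform1_ge0 // !qform1_eq0 (negPf x0).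
  by exists a, x => //; rewrite xA b0 scale0r subr0.
exists a, y; first by rewrite yA x0 scaler0 add0r.
apply: contra_neq v0 => y0; apply/rowP => k; rewrite !mxE.
move/rowP: x0 => /(_ k); move/rowP: y0 => /(_ k); rewrite !mxE.
by case: (v 0 k) => p q /= -> ->.
Qed.

Lemma reflection_involutive n (v : 'rV[R]_n) (s : R) (H := 1%:M - (2 / s) *: (v^T *m v)) :
  s != 0 -> v *m v^T = s%:M -> H *m H = 1%:M.
Proof.
move=> s0 vv; rewrite /H mulmxBl mul1mx -scalemxAl mulmxBr mulmx1 -scalemxAr.
have -> : v^T *m v *m (v^T *m v) = s *: (v^T *m v).
  by rewrite mulmxA -(mulmxA v^T) vv mul_mx_scalar -scalemxAl.
rewrite scalerBr !scalerA opprB addrA -!scaleNr -addrA -!scalerDl -[RHS]addr0.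
rewrite -addrA -scalerDl; congr (_ + _).
apply/eqP; rewrite scaler_eq0; apply/orP; left; apply/eqP.
by field.
Qed.

(** The reflection along [e - u] exchanges the unit vectors [e] and [u]; when they coincide, the
    identity serves. *)
Lemma householder n (u : 'rV[R]_n.+1) : u *m u^T = 1%:M ->
  exists2 H : 'M[R]_n.+1, orthogonal_mx H & delta_mx 0 0 *m H = u.
Proof.
move=> u1; set e : 'rV[R]_n.+1 := delta_mx 0 0.
have e1 : e *m e^T = 1%:M.
  by rewrite trmx_delta mul_delta_mx [RHS]mx11_scalar; apply/matrixP=> i j; rewrite !ord1 !mxE.
pose v := e - u; pose s := qform 1%:M v.
have [v0|v0] := eqVneq v 0.
  exists 1%:M; first by split; rewrite trmx1 mulmx1.
  by rewrite mulmx1; apply/eqP; rewrite -subr_eq0 -/v v0.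
have s0 : s != 0 by rewrite qform1_eq0.
have vv : v *m v^T = s%:M by rewrite [LHS]mx11_scalar /s /qform mulmx1.
pose H := 1%:M - (2 / s) *: (v^T *m v).
have HT : H^T = H by rewrite /H linearB /= linearZ /= trmx_mul trmxK trmx1.
have HH : H *m H = 1%:M by exact: reflection_involutive.
exists H; first by rewrite /orthogonal_mx HT.
(* As [e] and [u] have norm 1, s = |e - u|^2 = 2 - 2 e.u = 2 e.v. *)
have ev : e *m v^T = (s / 2)%:M.
  have ue : u *m e^T = e *m u^T.
    apply/matrixP => i j; rewrite !ord1 !row_mulmx_trE.
    by apply: eq_bigr => k _; exact: mulrC.
  have : s%:M = 2%:R *: (e *m v^T).
    rewrite -vv /v linearB /= mulmxBl !mulmxBr e1 u1 ue.
    by rewrite scaler_nat mulr2n opprB.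
  by move=> /(congr1 (fun M => 2^-1 *: M)); rewrite scalerA mulVf ?pnatr_eq0 // scale1r
     scale_scalar_mx mulrC => ->.
rewrite /H mulmxBr mulmx1 -scalemxAr mulmxA ev mul_scalar_mx scalerA.
have -> : 2 / s * (s / 2) = 1 by field.
by rewrite scale1r /v opprB addrC subrK.
Qed.

Lemma orthogonal_mxM n (U V : 'M[R]_n) :
  orthogonal_mx U -> orthogonal_mx V -> orthogonal_mx (U *m V).
Proof.
move=> [U1 U2] [V1 V2]; split; rewrite trmx_mul mulmxA.
  by rewrite -(mulmxA V^T) U1 mulmx1.
by rewrite -(mulmxA U) V2 mulmx1.
Qed.

Lemma orthogonal_mx_tr n (U : 'M[R]_n) : orthogonal_mx U -> orthogonal_mx U^T.
Proof. by case=> U1 U2; split; rewrite trmxK. Qed.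

(** Deflation: a Householder matrix moves a unit eigenvector to the first basis vector. Symmetry
    then clears the first row and column off the diagonal, and induction treats the remaining
    block. *)
Lemma symmetric_diagonalizable n (A : 'M[R]_n) : A^T = A ->
  exists U, exists2 d : 'rV[R]_n, orthogonal_mx U & A = U *m diag_mx d *m U^T.
Proof.
elim: n A => [|n IHn] A symA.
  by exists 1%:M, 0; [split|]; apply/matrixP => -[].
have [a [u uA u1]] := symmetric_eigenvector symA.
have [H [H1 H2] eH] := householder u1.
set e : 'rV[R]_n.+1 := delta_mx 0 0 in eH.
pose B : 'M[R]_(1 + n) := H *m A *m H^T.
have symB : B^T = B by rewrite /B !trmx_mul trmxK symA mulmxA.
have eB : e *m B = a *: e.
  by rewrite /B !mulmxA eH uA -scalemxAl -eH -mulmxA H2 mulmx1.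
have EA : A = H^T *m B *m H by rewrite /B !mulmxA H1 mul1mx -mulmxA H1 mulmx1.
clearbody B.
have B0 j : B 0 j = a * (j == 0)%:R.
  by have /rowP /(_ j) := eB; rewrite -rowE [LHS]mxE => ->; rewrite !mxE.
have l0 (i : 'I_1) : lshift n i = 0 by apply/val_inj; rewrite /= ord1.
have EB : B = block_mx a%:M 0 0 (drsubmx B).
  rewrite -[LHS]submxK; congr block_mx; apply/matrixP => i j.
  - by rewrite 2!mxE [RHS]mxE !l0 B0 !ord1 mulr1.
  - by rewrite 2!mxE [RHS]mxE !l0 B0 mulr0.
  - by rewrite -symB 2!mxE [RHS]mxE [LHS]mxE l0 B0 mulr0.
have [|U [d [U1 U2] EU]] := IHn (drsubmx B).
  by rewrite -{2}symB trmx_drsub.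
pose V : 'M[R]_(1 + n) := block_mx 1%:M 0 0 U.
have oV : orthogonal_mx V.
  by split; rewrite /V tr_block_mx mulmx_block !trmx0 !trmx1 !mulmx1 !mulmx0 !mul0mx !addr0 !add0r ?U1 ?U2 -scalar_mx_block.
pose D : 'rV[R]_(1 + n) := row_mx a%:M d.
have EV : B = V *m diag_mx D *m V^T.
  rewrite EB diag_mx_row /V tr_block_mx !mulmx_block !trmx0 !trmx1 EU.
  rewrite !mulmx1 !mul1mx !mulmx0 !mul0mx !addr0 !add0r !mul0mx.
  by congr block_mx; apply/matrixP => i j; rewrite !ord1 !mxE.
exists (H^T *m V), D.
  by apply: orthogonal_mxM => //; apply: orthogonal_mx_tr.
by rewrite EA EV trmx_mul trmxK !mulmxA.
Qed.

Lemma exists_spectral_decomp n (A : 'M[R]_n) : A^T = A ->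
  exists Ud, spectral_decomp A Ud.
Proof.
move=> /symmetric_diagonalizable [U [d [U1 U2] EA]].
have [s hs] := exists_sorting_perm (fun i => d 0 i).
exists (col_perm s U, \row_i d 0 (s i)); split => /=; last split => /=.
- split; apply/matrixP => i j.
    have /matrixP /(_ (s i) (s j)) := U1; rewrite !mxE (inj_eq perm_inj) => <-.
    by apply: eq_bigr => k _; rewrite !mxE.
  rewrite -U2 !mxE [RHS](reindex_inj (@perm_inj _ s)) /=.
  by apply: eq_bigr => k _; rewrite !mxE.
- apply/matrixP => i j; rewrite EA !mul_mx_diag !mxE (reindex_inj (@perm_inj _ s)) /=.
  by apply: eq_bigr => k _; rewrite !mxE.
- by move=> i j /hs; rewrite !mxE.
Qed.

End RealSpectralTheorem.

(** * Eigenvalue monotonicity and powers of symmetric matrices *)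

Section Spectrum.
Variable R : realType.

Lemma qform1_orthogonal n (U : 'M[R]_n) (v : 'rV[R]_n) :
  orthogonal_mx U -> qform 1%:M (v *m U) = qform 1%:M v.
Proof. by move=> [_ U2]; rewrite -qform_conj mulmx1 U2. Qed.

Lemma qform_spectral n (A : 'M[R]_n) U (a : 'rV[R]_n) v : spectral_decomp A (U, a) ->
  qform A v = \sum_i a 0 i * (v *m U) 0 i ^+ 2.
Proof. by move=> [_ [-> _]]; rewrite qform_conj qform_diag. Qed.

Lemma det_orthogonal_conj n (U : 'M[R]_n) (d : 'rV[R]_n) : orthogonal_mx U ->
  \det (U *m diag_mx d *m U^T) = \prod_i d 0 i.
Proof. by move=> [_ U2]; rewrite !det_mulmx det_diag mulrAC -det_mulmx U2 det1 mul1r. Qed.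

(* Weyl: the span of the first i+1 eigenvectors of A meets the span of the
   eigenvectors of B of index >= i, by a dimension count. *)
Lemma spectral_monotone n (A B : 'M[R]_n) U V (a b : 'rV[R]_n) :
  spectral_decomp A (U, a) -> spectral_decomp B (V, b) ->
  (forall v, qform A v <= qform B v) -> forall i, a 0 i <= b 0 i.
Proof.
move=> sA sB leAB i.
have [oU [_ a_dec]] := sA; have [oV [_ b_dec]] := sB; have [/= U1 U2] := oU.
pose P : 'M[R]_(i.+1, n) := pid_mx i.+1.
pose f : 'I_i -> 'I_n := widen_ord (ltnW (ltn_ord i)).
(* The rows of [P *m U^T] are the first [i.+1] eigenvectors of [A]; [N] holds their coordinates
   along the first [i] eigenvectors of [B]. With more rows than columns, [N] has a nonzero left
   kernel. *)
pose N := colsub f (P *m U^T *m V).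
have /rowV0Pn [y /sub_kermxP yN y0] : kermx N != 0.
  rewrite kermx_eq0 /row_free neq_ltn; apply/orP; left.
  by rewrite ltnS rank_leq_col.
pose v := y *m P *m U^T.
have vU : v *m U = y *m P by rewrite /v -mulmxA U1 mulmx1.
have vU0 (j : 'I_n) : (i < j)%N -> (v *m U) 0 j = 0.
  move=> ij; rewrite vU mxE big1 // => k _.
  by rewrite mxE (ltn_eqF (leq_ltn_trans _ ij)) ?mulr0 // -ltnS.
have vV0 (j : 'I_n) : (j < i)%N -> (v *m V) 0 j = 0.
  move=> ji; have /rowP /(_ (Ordinal ji)) := yN.
  rewrite /N mulmx_colsub !mulmxA !mxE => E; rewrite -[RHS]E.
  by apply: eq_bigr => k _; congr (_ * V _ _); apply/val_inj.
have v_gt0 : 0 < qform 1%:M v.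
  rewrite lt_neqAle eq_sym qform1_eq0 qform1_ge0 andbT.
  apply: contra_neq y0 => v0.
  have : v *m U *m (pid_mx i.+1 : 'M_(n, i.+1)) = 0 by rewrite v0 !mul0mx.
  rewrite vU -mulmxA mul_pid_mx minnn (minn_idPr (ltn_ord i)) pid_mx_1 mulmx1.
  by [].
(* The chain is a_i |v|^2 <= [qform A v] <= [qform B v] <= b_i |v|^2. *)
rewrite -(ler_pM2r v_gt0).
apply: (@le_trans _ _ (qform A v)).
  rewrite (qform_spectral _ sA) -(qform1_orthogonal _ oU) qform1 mulr_sumr.
  apply: ler_sum => j _; have [ji|ij] := leqP j i.
    by rewrite ler_wpM2r ?sqr_ge0 // a_dec.
  by rewrite vU0 // expr0n /= !mulr0.
apply: (le_trans (leAB v)).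
rewrite (qform_spectral _ sB) -(qform1_orthogonal _ oV) qform1 mulr_sumr.
apply: ler_sum => j _; have [ij|ji] := leqP i j.
  by rewrite ler_wpM2r ?sqr_ge0 // b_dec.
by rewrite vV0 // expr0n /= !mulr0.
Qed.

Lemma spectral_decomp_spec n (A : 'M[R]_n) : A^T = A -> spectral_decomp A (spec A).
Proof. by move=> /exists_spectral_decomp; exact: xgetPex. Qed.

Lemma trace_psd_pow n (A : 'M[R]_n) q : A^T = A ->
  \tr (psd_pow A q) = \sum_i powR (eigval A i) q.
Proof.
move=> /spectral_decomp_spec [[U1 _] _].
rewrite /psd_pow mxtrace_mulC mulmxA U1 mul1mx mxtrace_diag.
by apply: eq_bigr => i _; rewrite mxE.
Qed.

(** The chosen decomposition of [diag_mx d] need not be the obvious one, but its [U] intertwines [d]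
    and [a]: a nonzero [U i j] forces d_i = a_j, so [U] intertwines their powers too. *)
Lemma psd_pow_diag n (d : 'rV[R]_n) q :
  psd_pow (diag_mx d) q = diag_mx (\row_i powR (d 0 i) q).
Proof.
have := spectral_decomp_spec (tr_diag_mx d); rewrite /psd_pow.
case: (spec _) => U a [[/= U1 U2] [/= E _]].
suff -> : U *m diag_mx (\row_i powR (a 0 i) q) = diag_mx (\row_i powR (d 0 i) q) *m U.
  by rewrite -mulmxA U2 mulmx1.
have {}E : diag_mx d *m U = U *m diag_mx a.
  by rewrite E -mulmxA U1 mulmx1.
rewrite mul_mx_diag mul_diag_mx in E.
rewrite mul_mx_diag mul_diag_mx; apply/matrixP => i j.
have /matrixP /(_ i j) := E; rewrite !mxE => Eij.
have [->|Uij] := eqVneq (U i j) 0; first by rewrite mul0r mulr0.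
by rewrite (mulIf Uij (etrans Eij (mulrC _ _))) mulrC.
Qed.

(** Weyl's monotonicity, compared with the zero matrix. *)
Lemma psd_spectral_ge0 n (A : 'M[R]_n) U (a : 'rV[R]_n) :
  spectral_decomp A (U, a) -> (forall v, 0 <= qform A v) -> forall i, 0 <= a 0 i.
Proof.
move=> sA A0 i.
have s0 : spectral_decomp (0 : 'M[R]_n) (1%:M, 0).
  split; first by split; rewrite trmx1 mulmx1.
  by split=> /= [|j k _]; [rewrite linear0 mulmx0 mul0mx | rewrite !mxE].
have := spectral_monotone s0 sA _ i; rewrite mxE; apply=> v.
by rewrite /qform mulmx0 mul0mx mxE A0.
Qed.

End Spectrum.

(** * Products of truncated eigenvalues *)

Section Truncation.
Variable R : realType.

Lemma qform_le_spectral_sum n (K : 'M[R]_n) U (lam : 'rV[R]_n) :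
  spectral_decomp K (U, lam) -> (forall v, 0 <= qform K v) ->
  forall v, qform K v <= (\sum_i lam 0 i) * qform 1%:M v.
Proof.
move=> sK K0 v; have lam0 := psd_spectral_ge0 sK K0; have [oU _] := sK.
rewrite (qform_spectral _ sK) -(qform1_orthogonal _ oU) qform1 mulr_sumr.
apply: ler_sum => i _; rewrite ler_wpM2r ?sqr_ge0 //.
by rewrite (bigD1 i) //= lerDl sumr_ge0.
Qed.

(** In eigencoordinates X, Y of [x], [y], the right side minus the left is the sum of the lam_i e
    (X_i - Y_i)^2. *)
Lemma qform_perturb_le n (K : 'M[R]_n) U (lam : 'rV[R]_n) :
  spectral_decomp K (U, lam) -> (forall v, 0 <= qform K v) ->
  forall (e : R) (x y : 'rV[R]_n), 0 <= e ->
  qform K (x + e *: y) <= (1 + e) * (qform K x + e * qform K y).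
Proof.
move=> sK K0 e x y e0; have lam0 := psd_spectral_ge0 sK K0.
rewrite !(qform_spectral _ sK) mulr_sumr -big_split /= mulr_sumr.
apply: ler_sum => i _; rewrite mulmxDl -scalemxAl.
set X := x *m U; set Y := y *m U; rewrite [in leLHS]mxE [(e *: Y) _ _]mxE.
rewrite -subr_ge0.
have -> : (1 + e) * (lam 0 i * X 0 i ^+ 2 + e * (lam 0 i * Y 0 i ^+ 2)) -
  lam 0 i * (X 0 i + e * Y 0 i) ^+ 2 = lam 0 i * (e * (X 0 i - Y 0 i) ^+ 2) by ring.
by rewrite mulr_ge0 // mulr_ge0 // sqr_ge0.
Qed.

Lemma trmx_conj_diag n (V : 'M[R]_n) (d : 'rV[R]_n) :
  (V *m diag_mx d *m V^T)^T = V *m diag_mx d *m V^T.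
Proof. by rewrite !trmx_mul trmxK tr_diag_mx mulmxA. Qed.

(** The factor [t] pays for making the diagonal invertible: with [d] shifted by a small [e],
    [t *: At] still dominates the form of [K]. *)
Lemma prod_max_eigval_perturb n (K : 'M[R]_n) U V (lam al d : 'rV[R]_n) (c t : R) :
  spectral_decomp K (U, lam) -> (forall v, 0 <= qform K v) ->
  (forall i, 0 <= d 0 i) -> (forall i j : 'I_n, (i <= j)%N -> d 0 i <= d 0 j) ->
  spectral_decomp (diag_mx d *m K *m diag_mx d) (V, al) -> 0 < c -> 1 < t ->
  \prod_i Num.max (lam 0 i * d 0 i ^+ 2) c <= t ^+ n * \prod_i Num.max (al 0 i) c.
Proof.
move=> sK K0 d0 d_inc sA c0 t1.
have lam0 := psd_spectral_ge0 sK K0.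
have [[/= V1 V2] _] := sA.
pose At := V *m diag_mx (\row_i Num.max (al 0 i) c) *m V^T.
have qAt v : qform At v = \sum_i Num.max (al 0 i) c * (v *m V) 0 i ^+ 2.
  by rewrite qform_conj qform_diag; apply: eq_bigr => i _; rewrite [in LHS]mxE.
have At_c v : c * qform 1%:M v <= qform At v.
  rewrite qAt -(qform1_orthogonal _ (conj V1 V2)) qform1 mulr_sumr.
  by apply: ler_sum => i _; rewrite ler_wpM2r ?sqr_ge0 // le_max lexx orbT.
have At_A v : qform K (v *m diag_mx d) <= qform At v.
  rewrite -qform_conj tr_diag_mx qAt (qform_spectral _ sA).
  by apply: ler_sum => i _; rewrite ler_wpM2r ?sqr_ge0 // le_max lexx.
pose L := (\sum_i lam 0 i) / c.
have L0 : 0 <= L by rewrite divr_ge0 ?sumr_ge0 // ltW.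
(* Since e <= 1, (1 + e)(1 + e L) <= 1 + e (1 + 2 L) <= t. *)
pose e := Num.min 1 ((t - 1) / (1 + 2 * L)).
have den0 : 0 < 1 + 2 * L by lra.
have e0 : 0 < e by rewrite lt_min ltr01 divr_gt0 // subr_gt0.
have e1 : e <= 1 by rewrite ge_min lexx.
have et : (1 + e) * (1 + e * L) <= t.
  have : e <= (t - 1) / (1 + 2 * L) by rewrite ge_min lexx orbT.
  rewrite ler_pdivlMr // => h.
  have : e * e * L <= e * L by rewrite ler_wpM2r // ler_piMr // ltW.
  by nra.
pose d' i := d 0 i + e.
have d'0 i : 0 < d' i by rewrite /d' ltr_wpDl.
pose Di := diag_mx (\row_i (d' i)^-1).
pose M := Di *m (t *: At) *m Di.
have DiT : Di^T = Di by rewrite tr_diag_mx.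
have MT : M^T = M.
  by rewrite /M !trmx_mul DiT linearZ /= trmx_conj_diag mulmxA.
have qM v : qform M v = t * qform At (v *m Di).
  rewrite /M -{2}DiT qform_conj /qform -scalemxAr -scalemxAl.
  by rewrite [LHS]mxE.
have sM := spectral_decomp_spec MT.
case EM : (spec M) sM => [P mu] sM.
(* With [u] = [v *m Di], [v] is [u *m diag_mx d + e *: u]. The first summand is controlled by
   [At_A], the second by [L] times [qform At u], because [At] dominates [c] times the identity. *)
have KM v : qform K v <= qform M v.
  rewrite qM; set u := v *m Di.
  have -> : v = u *m diag_mx d + e *: u.
    apply/rowP => i; rewrite /u /Di !mul_mx_diag !mxE.
    by rewrite [e * _]mulrC -mulrDr -/(d' i) mulfVK // gt_eqF.
  apply: (le_trans (qform_perturb_le sK K0 _ _ (ltW e0))).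
  have u0 := qform1_ge0 u.
  have h1 : qform K u <= L * qform At u.
    apply: (le_trans (qform_le_spectral_sum sK K0 u)).
    by rewrite /L -mulrA ler_wpM2l ?sumr_ge0 // mulrC ler_pdivlMr // mulrC.
  have Atu0 : 0 <= qform At u by apply: le_trans (At_c u); rewrite mulr_ge0 // ltW.
  apply: le_trans (ler_wpM2r Atu0 et).
  rewrite -mulrA (ler_wpM2l (addr_ge0 ler01 (ltW e0))) // mulrDl mul1r lerD //.
  by rewrite -mulrA ler_wpM2l // ltW.
(* Because [d] increases, the entries c / d'_i^2 are already in decreasing order, so Weyl pairs them
   with [mu] at the same index as [lam]. *)
have sc : spectral_decomp (diag_mx (\row_i (c / d' i ^+ 2))) (1%:M, \row_i (c / d' i ^+ 2)).
  split; first by split; rewrite trmx1 mulmx1.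
  split=> /= [|i j ij]; first by rewrite trmx1 mulmx1 mul1mx.
  rewrite !mxE ler_wpM2l ?(ltW c0) // lef_pV2 ?posrE ?exprn_gt0 //.
  by rewrite ler_pXn2r ?nnegrE ?(ltW (d'0 _)) // lerD2r d_inc.
have cM v : qform (diag_mx (\row_i (c / d' i ^+ 2))) v <= qform M v.
  rewrite qM qform_diag.
  have h := At_c (v *m Di); apply: (@le_trans _ _ (c * qform 1%:M (v *m Di))).
    rewrite qform1 mulr_sumr; apply: ler_sum => i _.
    by rewrite /Di mul_mx_diag !mxE exprMn exprVn -mulrA [_^-1 * _]mulrC.
  apply: (le_trans h); rewrite ler_peMl ?(ltW t1) //.
  by apply: le_trans h; rewrite mulr_ge0 ?qform1_ge0 // ltW.
have mu1 := spectral_monotone sK sM KM.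
have mu2 := spectral_monotone sc sM cM.
(* The two Weyl bounds make each factor d'_i^2 mu_i at least the corresponding maximum; the whole
   product equals t^n det [At]. *)
apply: (@le_trans _ _ (\prod_i (d' i ^+ 2 * mu 0 i))).
  apply: ler_prod => i _; apply/andP; split; first by rewrite le_max (ltW c0) orbT.
  rewrite ge_max; apply/andP; split.
    rewrite mulrC; apply: ler_pM => //; first by rewrite exprn_ge0.
    by rewrite ler_pXn2r ?nnegrE ?(ltW (d'0 i)) // /d' lerDl ltW.
  by have := mu2 i; rewrite mxE ler_pdivrMr ?exprn_gt0 // mulrC.
have detMu : \det M = \prod_i mu 0 i.
  by have [oP [EP _]] := sM; rewrite EP /= det_orthogonal_conj.
have dDi : \prod_i d' i ^+ 2 * (\det Di * \det Di) = 1.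
  rewrite /Di det_diag -!big_split /= big1 // => i _.
  by rewrite mxE -expr2 exprVn mulfV // expf_neq0 // gt_eqF.
have detAt : \det At = \prod_i Num.max (al 0 i) c.
  by rewrite det_orthogonal_conj //; apply: eq_bigr => i _; rewrite mxE.
rewrite big_split /= -detMu /M !det_mulmx detZ detAt.
by rewrite [_ * _ * \det Di]mulrAC mulrA dDi mul1r.
Qed.

Lemma prod_max_eigval n (K : 'M[R]_n) U V (lam al d : 'rV[R]_n) (c : R) :
  spectral_decomp K (U, lam) -> (forall v, 0 <= qform K v) ->
  (forall i, 0 <= d 0 i) -> (forall i j : 'I_n, (i <= j)%N -> d 0 i <= d 0 j) ->
  spectral_decomp (diag_mx d *m K *m diag_mx d) (V, al) -> 0 < c ->
  \prod_i Num.max (lam 0 i * d 0 i ^+ 2) c <= \prod_i Num.max (al 0 i) c.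
Proof.
move=> sK K0 d0 d_inc sA c0; set x := leLHS; set y := leRHS.
have y0 : 0 < y by apply: prodr_gt0 => i _; rewrite lt_max c0 orbT.
rewrite leNgt; apply/negP => yx.
(* A ratio x / y > 1 would exceed t ^ n for t close to 1. *)
pose t := powR (x / y) n.+1%:R^-1.
have r1 : 1 < x / y by rewrite ltr_pdivlMr // mul1r.
(* The root has order [n.+1], not [n]: then t^n < t^(n+1) = x / y contradicts the bound, also for n
   = 0. *)
have tr : t ^+ n.+1 = x / y.
  by rewrite -powR_mulrn ?powR_ge0 // -powRrM mulVf ?pnatr_eq0 // powRr1 ?ltW // (lt_trans _ r1).
have t1 : 1 < t.
  rewrite ltNge; apply/negP => t1.
  by move: r1; rewrite -tr ltNge exprn_ile1 ?powR_ge0.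
have := prod_max_eigval_perturb sK K0 d0 d_inc sA c0 t1.
by rewrite -/x -/y -ler_pdivrMr // -tr leNgt ltr_eXn2l // ltnSn.
Qed.

End Truncation.

(** * From truncated products to sums of powers *)

Section Majorization.
Variable R : realType.

Lemma ln_prod n (x : 'I_n -> R) : (forall i, 0 < x i) ->
  ln (\prod_i x i) = \sum_i ln (x i).
Proof.
move=> x0; pose Q (p s : R) := 0 < p /\ ln p = s.
suff [] : Q (\prod_i x i) (\sum_i ln (x i)) by [].
apply: (big_rec2 Q) => [|i s p _ [p0 <-]]; first by rewrite /Q ln1.
by rewrite /Q mulr_gt0 // lnM // posrE.
Qed.

(** Abel summation: decreasing nonnegative weights are nonnegative combinations of indicators of
    initial segments. *)
Lemma abel_sum_ge0 n (s z : 'I_n -> R) :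
  (forall i, 0 <= s i) -> (forall i j : 'I_n, (i <= j)%N -> s j <= s i) ->
  (forall k : 'I_n, 0 <= \sum_(i < n | (i <= k)%N) z i) -> 0 <= \sum_i s i * z i.
Proof.
elim: n s z => [|n IHn] s z s0 sdec zpart; first by rewrite big_ord0.
(* The last weight can be subtracted from all of them, since the full sum is nonnegative. *)
have -> : \sum_i s i * z i =
    \sum_(i < n) (s (widen_ord (leqnSn n) i) - s ord_max) * z (widen_ord (leqnSn n) i)
    + s ord_max * \sum_i z i.
  rewrite [in RHS]big_ord_recr mulrDr mulr_sumr addrA -big_split /= big_ord_recr /=.
  by congr (_ + _); apply: eq_bigr => i _; ring.
apply: addr_ge0; last first.
  apply: mulr_ge0 => //; have := zpart ord_max.
  by rewrite (eq_bigl predT) // => i /=; rewrite -ltnS ltn_ord.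
apply: IHn => [i|i j ij|k].
- by rewrite subr_ge0; apply: sdec; exact: ltnW (ltn_ord i).
- by rewrite lerD2r sdec.
have := zpart (widen_ord (leqnSn n) k).
by rewrite (big_mkcond (fun i : 'I_n.+1 => _)) big_ord_recr /= leqNgt ltn_ord addr0 -big_mkcond.
Qed.

(** The convex function exp(q s) lies above its tangent at s = ln y. *)
Lemma powR_tangent (x y q : R) : 0 < x -> 0 < y ->
  powR y q * (q * (ln x - ln y)) <= powR x q - powR y q.
Proof.
move=> x0 y0; have -> : powR x q = powR y q * sequences.expR (q * (ln x - ln y)).
  by rewrite /powR !gt_eqF // -expRD; congr (sequences.expR _); ring.
rewrite -[X in _ <= _ - X]mulr1 -mulrBr ler_wpM2l ?powR_ge0 //.
by have := expR_ge1Dx (q * (ln x - ln y)); lra.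
Qed.

(** With [y] sorted into [a], the tangent inequality reduces the claim to a sum of ln x_i - ln a_i
    with decreasing weights q a_i^q, to which Abel summation applies. *)
Lemma sum_powR_le_of_trunc_prod_gt0 n (x y : 'I_n -> R) q : 0 <= q ->
  (forall i, 0 < x i) -> (forall i, 0 < y i) ->
  (forall i j : 'I_n, (i <= j)%N -> x j <= x i) ->
  (forall c, 0 < c -> \prod_i Num.max (y i) c <= \prod_i Num.max (x i) c) ->
  \sum_i powR (y i) q <= \sum_i powR (x i) q.
Proof.
move=> q0 x0 y0 xdec H.
have [s sdec] := exists_sorting_perm y.
rewrite (reindex_inj (@perm_inj _ s)) /= -subr_ge0 -sumrB.
pose a i := y (s i).
apply: (@le_trans _ _ (\sum_i q * powR (a i) q * (ln (x i) - ln (a i)))); last first.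
  apply: ler_sum => i _; apply: le_trans (powR_tangent _ (x0 i) (y0 (s i))).
  by rewrite mulrCA mulrA.
apply: abel_sum_ge0 => [i|i j ij|k].
- by rewrite mulr_ge0 ?powR_ge0.
- by rewrite ler_wpM2l // ge0_ler_powR ?nnegrE ?(ltW (y0 _)) // sdec.
have max0 (t : R) : 0 < Num.max t (x k) by rewrite lt_max x0 orbT.
(* Truncation at c = x_k isolates the partial sum up to [k]: for i <= k the maximum on the [x] side
   is x_i, and for i > k it is x_k, leaving a term at most 0. *)
have : ln (\prod_i Num.max (y i) (x k)) <= ln (\prod_i Num.max (x i) (x k)).
  by rewrite ler_ln ?posrE ?prodr_gt0 // H.
rewrite !ln_prod // (reindex_inj (@perm_inj _ s)) /= -subr_ge0 -sumrB => {}H.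
apply: (le_trans H); rewrite [in leRHS]big_mkcond /=; apply: ler_sum => i _.
case: leqP => ik.
  rewrite (max_idPl (xdec _ _ ik)) lerB // ler_ln ?posrE ?max0 ?y0 //.
  by rewrite le_max lexx.
rewrite (max_idPr (xdec _ _ (ltnW ik))) subr_le0 ler_ln ?posrE ?max0 ?x0 //.
by rewrite le_max lexx orbT.
Qed.

Lemma sum_powR_le_of_trunc_prod n (x y : 'I_n -> R) q : 0 < q ->
  (forall i, 0 <= x i) -> (forall i, 0 <= y i) ->
  (forall i j : 'I_n, (i <= j)%N -> x j <= x i) ->
  (forall c, 0 < c -> \prod_i Num.max (y i) c <= \prod_i Num.max (x i) c) ->
  \sum_i powR (y i) q <= \sum_i powR (x i) q.
Proof.
move=> q0 x0 y0 xdec H; apply/ler_addgt0Pr => e e0.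
(* Truncating both families at [c] makes them positive. Each of the [n] entries costs at most c^q =
   e / (n + 1), hence at most [e] in total; [n.+1] keeps the quotient meaningful for n = 0. *)
pose c := powR (e / n.+1%:R) q^-1.
have en0 : 0 < e / n.+1%:R by rewrite divr_gt0 ?ltr0n.
have c0 : 0 < c by rewrite powR_gt0.
have cq : powR c q = e / n.+1%:R by rewrite /c -powRrM mulVf ?gt_eqF // powRr1 ?ltW.
have max0 (t : R) : 0 < Num.max t c by rewrite lt_max c0 orbT.
apply: (@le_trans _ _ (\sum_i powR (Num.max (y i) c) q)).
  apply: ler_sum => i _; rewrite ge0_ler_powR ?(ltW q0) ?nnegrE ?(ltW (max0 _)) //.
  by rewrite le_max lexx.
apply: (@le_trans _ _ (\sum_i powR (Num.max (x i) c) q)).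
  apply: sum_powR_le_of_trunc_prod_gt0 => [|i|i|i j ij|b b0] //; first exact: ltW.
    by rewrite ge_max !le_max lexx xdec //= orbT.
  under eq_bigr do rewrite -maxA; under [leRHS]eq_bigr do rewrite -maxA.
  by apply: H; rewrite lt_max c0.
apply: (@le_trans _ _ (\sum_i (powR (x i) q + e / n.+1%:R))).
  apply: ler_sum => i _; rewrite -cq.
  by have := powR_ge0 (x i) q; have := powR_ge0 c q; case: (leP (x i) c) => _ ? ?; lra.
rewrite big_split /= lerD2l sumr_const card_ord -[leLHS]mulr_natr.
by rewrite -mulrA ler_piMr ?(ltW e0) // mulrC ler_pdivrMr ?ltr0n // mul1r ler_nat.
Qed.

End Majorization.

(** * Attainment and lower bound for the trace objective *)

Lemma qform_gram_ge0 (R : realType) l n (Y : 'M[R]_(l, n)) v : 0 <= qform (Y^T *m Y) v.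
Proof.
by have := qform_conj Y^T 1%:M v; rewrite mulmx1 trmxK => ->; exact: qform1_ge0.
Qed.

(** Turns the (p/2)-th power of lam_i d_i^2, with d_i = w_i^(1/p), into the weighted term w_i
    sigma_i^p. *)
Lemma powR_weighted_eigval (R : realType) (lam w p : R) : 0 < p -> 0 <= lam -> 0 <= w ->
  powR (lam * powR w p^-1 ^+ 2) (p / 2) = w * powR (Num.sqrt lam) p.
Proof.
move=> p0 lam0 w0; rewrite powRM ?exprn_ge0 ?powR_ge0 // mulrC.
rewrite -(powR12_sqrt lam0) -powRrM (mulrC _ p); congr (_ * _).
rewrite -powR_mulrn ?powR_ge0 // -!powRrM.
have -> : p^-1 * (2%:R * (p / 2)) = 1 by field; rewrite gt_eqF.
by rewrite powRr1.
Qed.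

Theorem lemma4 (R : realType) (m l n : nat) (p : R)
  (phi : 'cV[R]_m -> 'cV[R]_l) (X : 'M[R]_(m, n)) (w : 'I_n -> R) :
  0 < p -> p <= 1 ->
  (forall i : 'I_n, 0 <= w i) ->
  (forall i j : 'I_n, (i <= j)%N -> w i <= w j) ->
  let W := diag_mx (\row_i w i) in
  let K := kernel_mx phi X in
  let lhs := \sum_(i < n) w i * powR (sing_val (feat_mx phi X) i) p in
  let obj := fun Q : 'M[R]_n =>
    \tr (psd_pow (psd_pow W p^-1 *m Q^T *m K *m Q *m psd_pow W p^-1) (p / 2)) in
  (exists2 Q : 'M[R]_n, orthogonal_mx Q & obj Q = lhs) /\
  (forall Q : 'M[R]_n, orthogonal_mx Q -> lhs <= obj Q).
Proof.
move=> p0 _ w0 w_inc W K lhs obj.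
have K_psd v : 0 <= qform K v by exact: qform_gram_ge0.
have KT : K^T = K by rewrite /K /kernel_mx trmx_mul trmxK.
case EK : (spec K) (spectral_decomp_spec KT) => [U lam] sK.
have [[/= U1 U2] [/= EKU lam_dec]] := sK.
have lam0 := psd_spectral_ge0 sK K_psd.
pose d := \row_i powR (w i) p^-1.
have d0 i : 0 <= d 0 i by rewrite mxE powR_ge0.
have d_inc (i j : 'I_n) : (i <= j)%N -> d 0 i <= d 0 j.
  by move=> ij; rewrite !mxE ge0_ler_powR ?nnegrE ?invr_ge0 ?(ltW p0) // w_inc.
have WE : psd_pow W p^-1 = diag_mx d.
  by rewrite psd_pow_diag; congr diag_mx; apply/rowP => i; rewrite !mxE.
have objE Q : obj Q = \tr (psd_pow (diag_mx d *m (Q^T *m K *m Q) *m diag_mx d) (p / 2)).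
  by rewrite /obj WE !mulmxA.
have lhsE : lhs = \sum_i powR (lam 0 i * d 0 i ^+ 2) (p / 2).
  apply: eq_bigr => i _; rewrite [d 0 i]mxE powR_weighted_eigval //.
  by rewrite /sing_val /eigval -/(kernel_mx phi X) -/K EK.
split=> [|Q oQ].
  exists U => //; rewrite objE lhsE.
  have -> : U^T *m K *m U = diag_mx lam.
    by rewrite EKU !mulmxA U1 mul1mx -mulmxA U1 mulmx1.
  have -> : diag_mx d *m diag_mx lam *m diag_mx d = diag_mx (\row_i (lam 0 i * d 0 i ^+ 2)).
    rewrite !mulmx_diag; congr diag_mx; apply/rowP => i; rewrite !mxE; ring.
  rewrite psd_pow_diag mxtrace_diag.
  by apply: eq_bigr => i _; rewrite !mxE.
have [Q1 Q2] := oQ.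
(* Conjugation by [Q] keeps the spectrum [lam], so the truncated product bound applies with
   [Q^T *m K *m Q] in place of [K]. *)
have sK' : spectral_decomp (Q^T *m K *m Q) (Q^T *m U, lam).
  split; first by apply: orthogonal_mxM => //; exact: orthogonal_mx_tr.
  by split=> //=; rewrite trmx_mul trmxK EKU !mulmxA.
have K'_psd v : 0 <= qform (Q^T *m K *m Q) v.
  by rewrite -{2}(trmxK Q) qform_conj.
rewrite objE lhsE; set A := diag_mx d *m _ *m diag_mx d.
have K'T : (Q^T *m K *m Q)^T = Q^T *m K *m Q.
  by rewrite (trmx_mul (_ *m K)) (trmx_mul _ K) trmxK KT mulmxA.
have AT : A^T = A.
  by rewrite /A trmx_mul (trmx_mul (diag_mx d)) K'T tr_diag_mx mulmxA.
rewrite trace_psd_pow // /eigval.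
case: (spec A) (spectral_decomp_spec AT) => [V al] sA /=.
have A_psd v : 0 <= qform A v by rewrite /A -{2}tr_diag_mx qform_conj.
apply: sum_powR_le_of_trunc_prod => [|i|i|i j|c c0].
- by rewrite divr_gt0.
- exact: psd_spectral_ge0 sA A_psd i.
- by rewrite mulr_ge0 // exprn_ge0.
- by have [_ [_]] := sA; apply.
- exact: prod_max_eigval sK' K'_psd d0 d_inc sA c0.
Qed.
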